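(* Let $q$ be a prime power and $m,n$ positive integers. Then: (1) for every positive integer $\ell \leq mn$, there exists an $\mathbb{F}_q$-linear code $\mathcal{C} \subsetneqq \mathbb{F}_q^{m \times n}$ whose nested pair $\mathcal{C} \subsetneqq \mathbb{F}_q^{m\times n}$ has information parameter $\ell$ and security parameter $t = \min\{m,n\} - \lceil \ell / \max\{m,n\} \rceil$; (2) for every positive integer $t \leq \min\{m,n\} - 1$, there exists an $\mathbb{F}_q$-linear code $\mathcal{C} \subsetneqq \mathbb{F}_q^{m \times n}$ whose nested pair $\mathcal{C} \subsetneqq \mathbb{F}_q^{m\times n}$ has security parameter $t$ and information parameter $\ell = \max\{m,n\}(\min\{m,n\} - t)$.
   Context: For an $\mathbb{F}_q$-linear code $\mathcal{C} \subsetneqq \mathbb{F}_q^{m \times n}$, the nested pair $\mathcal{C} \subsetneqq \mathbb{F}_q^{m\times n}$ is used as follows: with $\ell = mn - \dim \mathcal{C}$, fix a complement $\mathcal{W}$ with $\mathbb{F}_q^{m\times n} = \mathcal{C} \oplus \mathcal{W}$ and an isomorphism $\psi:\mathbb{F}_q^\ell \to \mathcal{W}$; a uniform message $\mathbf{x} \in \mathbb{F}_q^\ell$ is encoded as $C = \psi(\mathbf{x}) + D$ with $D$ uniform on $\mathcal{C}$, independent of $\mathbf{x}$. The information parameter of the pair is $\ell = mn - \dim(\mathcal{C})$ (equivalently $\dim(\mathcal{C}^\perp)$, where $\mathcal{C}^\perp$ is the dual with respect to $\langle C, D\rangle = {\rm Trace}(CD^T)$). Its security parameter $t$ is the largest integer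 $\mu$ such that the mutual information $I(\mathbf{x}; CB^T) = 0$ for every matrix $B \in \mathbb{F}_q^{\mu \times n}$ (an adversary observing $CB^T$ corresponds to wire-tapping $\mu$ links). *)

(* Defs.v *)
From HB Require Import structures.
From mathcomp Require Import all_boot all_order all_algebra.
From mathcomp Require Import Rstruct.
From mathcomp Require Import vector.
From Stdlib Require Rpower.
From Stdlib Require Import Rdefinitions.
Set Implicit Arguments. Unset Strict Implicit. Unset Printing Implicit Defensive.
Import Order.TTheory GRing.Theory Num.Theory.
Local Open Scope ring_scope.

Definition uprob (Omega : finType) (S E : {pred Omega}) : R :=
  (#|[pred w | S w && E w]|%:R / #|[pred w | S w]|%:R).

(* Mutual information I(X;Y) (natural logarithm; the base is irrelevant
   for the statement I = 0), with the convention 0 * ln 0 = 0, of random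
   variables X, Y defined on the uniform probability space on S. *)
Definition mutual_info (Omega A B : finType) (S : {pred Omega})
    (X : Omega -> A) (Y : Omega -> B) : R :=
  \sum_(a : A) \sum_(b : B)
    let pab := uprob S (fun w => (X w == a) && (Y w == b)) in
    if pab == 0 then 0
    else pab * Rpower.ln (pab / (uprob S (fun w => X w == a) *
                          uprob S (fun w => Y w == b))).

Section NestedPair.
Variables (F : finFieldType) (m n : nat).

Definition info_param (C : {vspace 'M[F]_(m, n)}) : nat := subn (muln m n) (\dim C).

Definition admissible_encoder (C : {vspace 'M[F]_(m, n)})
    (psi : 'Hom('rV[F]_(info_param C), 'M[F]_(m, n))) : Prop :=
  (lker psi == 0)%VS /\ directv (C + limg psi)%VS /\ (C + limg psi == fullv)%VS.

(* Sample space: pairs (x, D) with x uniform in F^l and D uniform in C,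
   independent; the codeword is psi x + D; the adversary sees (psi x + D) B^T. *)
Definition secure_for (C : {vspace 'M[F]_(m, n)})
    (psi : 'Hom('rV[F]_(info_param C), 'M[F]_(m, n))) (mu : nat) : Prop :=
  forall B : 'M[F]_(mu, n),
    mutual_info (fun w : 'rV[F]_(info_param C) * 'M[F]_(m, n) => w.2 \in C)
      (fun w => w.1) (fun w => (psi w.1 + w.2) *m B^T) = 0.

Definition is_security_param_for (C : {vspace 'M[F]_(m, n)})
    (psi : 'Hom('rV[F]_(info_param C), 'M[F]_(m, n))) (t : nat) : Prop :=
  secure_for psi t /\ forall mu, secure_for psi mu -> leq mu t.

Definition has_security_param (C : {vspace 'M[F]_(m, n)}) (t : nat) : Prop :=
  forall psi : 'Hom('rV[F]_(info_param C), 'M[F]_(m, n)),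
    admissible_encoder psi -> is_security_param_for psi t.

End NestedPair.

Definition ceil_div (a b : nat) : nat := divn (addn a b.-1) b.

(* Main.v *)
(** With respect to the trace form, the pair C < F^(m x n) leaks nothing
through mu links iff every D B^T is attained on C, i.e. iff the dual code E of C
contains no nonzero matrix of rank at most mu; so the security parameter is the
minimum rank distance of E minus one. Take for E an l-dimensional subcode of a
Gabidulin code (evaluations of linearized polynomials over the extension of
degree max(m, n), up to transposition): its distance is bounded below by
counting roots, and above by the Singleton argument. When C misses some D B^T,
the mutual information is positive because ln x >= 1 - 1/x bounds it below by
the mass that the product of the marginal laws puts off the support of the
joint law. Part (2) is part (1) for l = max(m, n) (min(m, n) - t). *)

From Stdlib Require Rpower.
From Stdlib Require Import Rdefinitions.
Require Import Defs.
From HB Require Import structures.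
From mathcomp Require Import all_boot all_order all_algebra all_field.
From mathcomp Require Import pgroup Rstruct zify.
Import Order.TTheory GRing.Theory Num.Theory.
Import VectorInternalTheory.
Set Implicit Arguments.
Unset Strict Implicit.
Unset Printing Implicit Defensive.
Local Open Scope ring_scope.

(** * Gabidulin codes *)

(** Being a power of the characteristic is what makes raising to the power q^i additive. *)
Lemma card_pchar_nat (F : finFieldType) (A : lalgType F) (i : nat) :
  [pchar A].-nat (#|F| ^ i)%N.
Proof.
have [p p_pr pcharF] := finPcharP F.
rewrite (eq_pnat _ (pchar_lalg A)) pnatX (eq_pnat _ (pcharf_eq pcharF)).
by have := pprimeChar_pgroup pcharF; rewrite /pgroup cardsT => ->.
Qed.

(** The splitting field of ['X^m - 'X], with m = q^N, works: the roots are distinct and are the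
    fixed points of the N-th power of the Frobenius, so they fill the field, which thus has q^N
    elements. *)
Lemma ext_field_exists (F : finFieldType) (N : nat) :
  (0 < N)%N -> exists L : fieldExtType F, dim L = N.
Proof.
move=> N_gt0; set m := (#|F| ^ N)%N.
have m_gt1 : (1 < m)%N by rewrite -(expn0 #|F|) ltn_exp2l ?finNzRing_gt1.
have m_gt0 := ltnW m_gt1; have m1_gt0 : (0 < m.-1)%N by rewrite -ltnS prednK.
pose q := 'X^m - 'X; have Dq R : q R = ('X^(m.-1) - 1) * ('X - 0).
  by rewrite subr0 mulrBl mul1r -exprSr prednK.
have /FinSplittingFieldFor[/= L splitLq] : q F != 0.
  by rewrite Dq monic_neq0 ?rpredM ?monicXsubC ?monicXnsubC.
rewrite [map_poly _ _]rmorphB rmorphXn /= map_polyX -/(q L) in splitLq.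
have [p p_pr pcharF] := finPcharP F.
have pcharL : p \in [pchar L] by rewrite pchar_lalg.
have m0 : m%:R = 0 :> L.
  apply/eqP; rewrite -(dvdn_pcharf pcharL) /m.
  have := card_pchar_nat L N.
  rewrite (eq_pnat _ (pcharf_eq pcharL)) => /p_natP[[|e] De].
    by move: m_gt1; rewrite /m De.
  by rewrite De dvdn_exp.
exists L; have [a _ Da] := finField_galois_generator (sub1v {:L}).
pose Em := fixedSpace (a ^+ N)%g; rewrite dimv1 expn1 in Da.
have{splitLq} [zs DqL defL] := splitLq.
(* 0 is not a root of ['X^(m.-1) - 1], and this factor is separable because m = 0 in [L] makes m - 1
   nonzero there. *)
have Uzs : uniq zs.
  rewrite -separable_prod_XsubC -(eqp_separable DqL) Dq separable_root andbC.
  rewrite /root !hornerE subr_eq0 eq_sym expr0n gtn_eqF ?oner_eq0 //=.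
  by rewrite separable_Xn_sub_1 // -subn1 natrB // subr_eq0 m0 eq_sym oner_eq0.
have in_zs : zs =i Em.
  move=> z; rewrite -root_prod_XsubC -(eqp_root DqL) (sameP fixedSpaceP eqP).
  rewrite /root !hornerE subr_eq0 /= /m; congr (_ == z).
  elim: (N) => [|i IHi]; first by rewrite gal_id.
  by rewrite expgSr expnSr exprM IHi galM ?Da ?memvf.
have defEm : Em = {:L}%VS.
  apply/eqP; rewrite eqEsubv subvf -defL -[Em]subfield_closed agenvS //.
  by rewrite subv_add sub1v; apply/span_subvP=> z; rewrite in_zs.
have Ezs : {:finvect_type L}%VS =i zs by move=> z; rewrite in_zs defEm.
have: #|{:finvect_type L}%VS| = m.
  apply: succn_inj; rewrite (eq_card Ezs) (card_uniqP _) //= -(size_prod_XsubC _ id).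
  by rewrite -(eqp_size DqL) size_polyDl size_polyXn // size_polyN size_polyX.
rewrite card_vspace dimvf => /eqP.
by rewrite /m eqn_exp2l ?finNzRing_gt1 // => /eqP.
Qed.

Section LinearizedPoly.
Variables (F : finFieldType) (L : fieldExtType F).
Local Notation q := #|F|.

Lemma Frobenius_linear (i : nat) (c : F) (x y : L) :
  (c *: x + y) ^+ (q ^ i) = c *: x ^+ (q ^ i) + y ^+ (q ^ i).
Proof.
rewrite exprDn_pchar ?card_pchar_nat // exprZn; congr (_ *: _ + _).
by elim: i => // i IH; rewrite expnS exprM expf_card.
Qed.

Variable k : nat.

(* The coefficients a_0, ..., a_(k-1) are packed in F-coordinates in u. *)
Definition qpoly_coef (u : 'rV[F]_(k * dim L)) (i : 'I_k) : L :=
  r2v (row i (vec_mx u)).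

Definition qpoly_eval (u : 'rV[F]_(k * dim L)) (x : L) : L :=
  \sum_(i < k) qpoly_coef u i * x ^+ (q ^ i).

Fact qpoly_eval_linear u : linear (qpoly_eval u).
Proof.
move=> c x y; rewrite /qpoly_eval scaler_sumr -big_split /=.
by apply: eq_bigr => i _; rewrite Frobenius_linear mulrDr scalerAr.
Qed.
HB.instance Definition _ u :=
  GRing.isLinear.Build F L L *:%R (qpoly_eval u) (qpoly_eval_linear u).

Lemma qpoly_evalP c u v x :
  qpoly_eval (c *: u + v) x = c *: qpoly_eval u x + qpoly_eval v x.
Proof.
rewrite /qpoly_eval scaler_sumr -big_split /=; apply: eq_bigr => i _.
by rewrite /qpoly_coef !linearP mulrDl scalerAl.
Qed.

Variable M : nat.

(** For M <= dim L, row i holds the coordinates of the value at the i-th basis vector of [L]. *)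
Definition gabidulin (u : 'rV[F]_(k * dim L)) : 'M[F]_(M, dim L) :=
  lin1_mx (v2r \o qpoly_eval u \o r2v \o mulmxr (pid_mx M)).

Fact gabidulin_linear : linear gabidulin.
Proof.
by move=> c u v; apply/matrixP=> i j; rewrite !mxE /= qpoly_evalP linearP !mxE.
Qed.
HB.instance Definition _ :=
  GRing.isLinear.Build F _ _ *:%R gabidulin gabidulin_linear.

(** A left kernel of rank at least k would give q^k roots to a polynomial of degree at most
    q^(k-1). *)
Lemma gabidulin_rank (u : 'rV[F]_(k * dim L)) :
  (0 < k)%N -> (k <= M)%N -> (M <= dim L)%N -> u != 0 ->
  (M - k < \rank (gabidulin u))%N.
Proof.
move=> k_gt0 kM MN; apply: contraNltn => rk_le.
set K := kermx (gabidulin u).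
have k_le : (k <= \rank K)%N.
  by rewrite mxrank_ker leq_subCr //; apply: leq_trans rk_le _; rewrite leq_subr.
(* [r] embeds F^k into the left kernel, viewed inside [L]. *)
pose r (w : 'rV[F]_k) : L := r2v (w *m pid_mx k *m row_base K *m pid_mx M).
have r_inj : injective r.
  move=> w1 w2 /r2v_inj.
  have fM : row_free (pid_mx M : 'M[F]_(M, dim L)).
    by rewrite /row_free rank_pid_mx.
  have fk : row_free (pid_mx k : 'M[F]_(k, \rank K)).
    by rewrite /row_free rank_pid_mx.
  by move/(row_free_inj fM)/(row_free_inj (row_base_free K))/(row_free_inj fk).
pose P : {poly L} := \sum_(i < k) qpoly_coef u i *: 'X^(q ^ i).
have P_eval x : P.[x] = qpoly_eval u x.
  rewrite horner_sum; apply: eq_bigr => i _.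
  by rewrite hornerZ hornerXn.
have P_root w : root P (r w).
  rewrite /root P_eval -[qpoly_eval u _](v2rK) -(rwP eqP).
  have: w *m pid_mx k *m row_base K *m gabidulin u = 0.
    by apply/sub_kermxP; rewrite (submx_trans (submxMl _ _)) ?eq_row_base.
  by rewrite mul_rV_lin1 /= => ->; rewrite linear0.
have q_gt1 : (1 < q)%N := finNzRing_gt1 F.
have P0 : P = 0.
  apply/eqP/negPn/negP=> P_neq0.
  have := @max_poly_roots _ P [seq r w | w : 'rV[F]_k] P_neq0.
  rewrite map_inj_uniq ?enum_uniq // size_map -cardE card_mx mul1n => lt_size.
  have/lt_size/(_ isT) : all (root P) [seq r w | w : 'rV[F]_k].
    by apply/allP=> _ /mapP[w _ ->].
  rewrite ltnNge => /negP; apply.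
  apply: leq_trans (size_sum _ _ _) _; apply/bigmax_leqP=> i _.
  apply: leq_trans (size_scale_leq _ _) _.
  by rewrite size_polyXn ltn_exp2l.
apply/eqP; rewrite -[u]vec_mxK -[0](linear0 mxvec); congr mxvec.
apply/row_matrixP=> i; rewrite row0; apply: r2v_inj; rewrite linear0.
have: P`_(q ^ i) = 0 by rewrite P0 coef0.
rewrite coef_sum (bigD1 i) //= coefZ coefXn eqxx mulr1 big1 ?addr0 // => j ji.
rewrite coefZ coefXn eqn_exp2l // eq_sym.
by rewrite (negPf (_ : (j : nat) != i)) ?mulr0.
Qed.

End LinearizedPoly.

(** * Dual codes *)

Lemma linear_nontrivial_zero (F : fieldType) (l n1 n2 : nat)
    (f : {linear 'rV[F]_l -> 'M[F]_(n1, n2)}) :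
  (n1 * n2 < l)%N -> exists2 u, u != 0 & f u = 0.
Proof.
move=> lt_l; set A := lin1_mx (mxvec \o f).
have /rowV0Pn[u /sub_kermxP uA u_neq0] : kermx A != 0.
  rewrite -mxrank_eq0 mxrank_ker subn_eq0 -ltnNge.
  exact: leq_ltn_trans (rank_leq_col A) lt_l.
exists u => //; apply: (can_inj mxvecK).
by move: uA; rewrite mul_rV_lin1 /= => ->; rewrite linear0.
Qed.

(* Singleton bound: some nonzero codeword vanishes on the first s rows. *)
Lemma small_rank_codeword (F : fieldType) (l m n s : nat)
    (f : {linear 'rV[F]_l -> 'M[F]_(m, n)}) :
  (s <= m)%N -> (s * n < l)%N -> exists2 u, u != 0 & (\rank (f u) <= m - s)%N.
Proof.
move=> le_s lt_l.
have [u u_neq0 fu0] := linear_nontrivial_zero (mulmx (pid_mx s : 'M_(s, m)) \o f) lt_l.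
exists u => //.
have /mxrankS : ((pid_mx s : 'M[F]_(s, m)) <= kermx (f u))%MS by apply/sub_kermxP.
by rewrite mxrank_ker rank_pid_mx // leq_subCr ?rank_leq_row.
Qed.

Lemma trace_delta_mul (F : fieldType) (p r : nat) (A : 'M[F]_(p, r)) i j :
  \tr (delta_mx j i *m A) = A i j.
Proof.
rewrite /mxtrace (bigD1 j) //= big1 ?addr0 => [|k kj]; rewrite mxE.
  rewrite (bigD1 i) //= big1 ?addr0 => [|k ki]; rewrite !mxE ?eqxx ?mul1r //.
  by rewrite (negPf ki) andbF mul0r.
by rewrite big1 // => x _; rewrite !mxE (negPf kj) mul0r.
Qed.

Lemma mulmx_factor (F : fieldType) (m n : nat) (A : 'M[F]_(m, n)) (mu : nat) :
  (\rank A <= mu)%N ->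
  exists X : 'M[F]_(m, mu), exists Y : 'M[F]_(mu, n), A = X *m Y.
Proof.
move=> rk; exists (col_ebase A *m pid_mx (\rank A)).
exists (pid_mx (\rank A) *m row_ebase A).
rewrite -{1}[A]mulmx_ebase -!mulmxA; congr (_ *m _); rewrite mulmxA mul_pid_mx.
by rewrite minnn (minn_idPr rk).
Qed.

Section DualCode.
Variables (F : fieldType) (l m n : nat) (f : {linear 'rV[F]_l -> 'M[F]_(m, n)}).

(** Trace pairings with the images of the unit vectors, so that the kernel is the dual of the image
    of [f]. *)
Definition syndrome (D : 'M[F]_(m, n)) : 'rV[F]_l :=
  \row_i \tr (D *m (f (delta_mx 0 i))^T).

Fact syndrome_linear : linear syndrome.
Proof.
by move=> c D1 D2; apply/rowP=> i; rewrite !mxE mulmxDl -scalemxAl linearP.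
Qed.
HB.instance Definition _ :=
  GRing.isLinear.Build F _ _ *:%R syndrome syndrome_linear.

Definition dual_code : {vspace 'M[F]_(m, n)} := lker (linfun syndrome).

Lemma dual_codeP D : reflect (syndrome D = 0) (D \in dual_code).
Proof. by rewrite memv_ker lfunE; apply: eqP. Qed.

Lemma syndromeE D (u : 'rV[F]_l) :
  syndrome D *m u^T = (\tr (D *m (f u)^T))%:M.
Proof.
rewrite [_%:M]mx11_scalar [LHS]mx11_scalar; congr (_%:M); rewrite !mxE mulr1n.
rewrite {2}[u]row_sum_delta linear_sum /= linear_sum /= mulmx_sumr linear_sum.
by apply: eq_bigr => i _; rewrite !mxE linearZ /= linearZ /= -scalemxAr linearZ mulrC.
Qed.

Section LargeDistance.
Variable t : nat.
Hypothesis rank_f : forall u, u != 0 -> (t < \rank (f u))%N.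

(** If u is orthogonal to the syndromes of all [P *m kermx B^T], then [kermx B^T *m (f u)^T = 0], so
    [f u] has rank at most that of B, hence at most t, and u = 0. *)
Lemma syndrome_onto (B : 'M[F]_(t, n)) (w : 'rV[F]_l) :
  exists2 K : 'M[F]_(m, n), K *m B^T = 0 & syndrome K = w.
Proof.
pose Z := kermx B^T; pose S := lin1_mx (syndrome \o mulmxr Z \o vec_mx).
suff S_full : row_full S.
  have /submxP[v ->] := submx_full w S_full.
  exists (vec_mx v *m Z); first by rewrite -mulmxA mulmx_ker mulmx0.
  by rewrite mul_rV_lin1.
rewrite -cokermx_eq0 -trmx_eq0; apply/rowV0P => _ /submxP[y ->].
set u := _ *m _; apply/eqP/negPn/negP=> u_neq0.
have trZ P : \tr (P *m (Z *m (f u)^T)) = 0.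
  have: mxvec P *m S *m u^T = 0.
    by rewrite trmx_mul trmxK mulmxA -(mulmxA _ S) mulmx_coker mulmx0 mul0mx.
  rewrite mul_rV_lin1 /= mxvecK syndromeE => /(congr1 (fun X : 'M_1 => X 0 0)).
  by rewrite !mxE mulr1n mulmxA.
have /sub_kermxP/mxrankS : Z *m (f u)^T = 0.
  by apply/matrixP=> i j; rewrite -trace_delta_mul trZ mxE.
rewrite !mxrank_ker leq_sub2lE ?rank_leq_row // !mxrank_tr leqNgt.
by rewrite (leq_ltn_trans (rank_leq_row B)) ?rank_f.
Qed.

Lemma dim_dual_code : (\dim dual_code + l = m * n)%N.
Proof.
have := limg_ker_dim (linfun syndrome) fullv.
rewrite capfv -/dual_code dimvf /dim /= => <-; congr (_ + _)%N.
suff -> : limg (linfun syndrome) = fullv by rewrite dimvf /dim /= mul1n.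
apply/eqP; rewrite eqEsubv subvf /=; apply/subvP=> w _.
(* For B = 0 the condition on K is void and plain surjectivity remains. *)
have [K _ <-] := syndrome_onto 0 w.
by rewrite -[syndrome K]lfunE memv_img ?memvf.
Qed.

Lemma dual_code_mulmx (B : 'M[F]_(t, n)) (D : 'M[F]_(m, n)) :
  exists2 D', D' \in dual_code & D' *m B^T = D *m B^T.
Proof.
have [K KB sK] := syndrome_onto B (syndrome D).
exists (D - K); last by rewrite mulmxBl KB subr0.
by apply/dual_codeP; rewrite linearB /= sK subrr.
Qed.

End LargeDistance.

(** Writing [f u = X *m B], the trace of [D *m (f u)^T] depends only on [D *m B^T]. It vanishes on
    the dual code, but not at the matrix unit of a nonzero entry of [f u]. *)
Lemma dual_code_not_mulmx (mu : nat) (u : 'rV[F]_l) :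
  f u != 0 -> (\rank (f u) <= mu)%N ->
  exists B : 'M[F]_(mu, n), exists D : 'M[F]_(m, n),
    forall D', D' \in dual_code -> D' *m B^T <> D *m B^T.
Proof.
move=> fu_neq0 /mulmx_factor[X [B fuE]]; exists B.
have /matrix0Pn[i [j fuij]] := fu_neq0.
exists (delta_mx i j) => D' /dual_codeP sD' /(congr1 (fun Y => \tr (Y *m X^T))).
rewrite -!mulmxA -trmx_mul -fuE trace_delta_mul mxE => trE.
have := syndromeE D' u; rewrite sD' mul0mx trE => /(congr1 (fun Y : 'M_1 => Y 0 0)).
by rewrite !mxE mulr1n => /esym/eqP; apply/negP.
Qed.

End DualCode.

(** * Mutual information *)

(** This is exp y >= 1 + y at y = - ln x. *)
Lemma ln_ge_subVr (x : R) : 0 < x -> 1 - x^-1 <= Rpower.ln x.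
Proof.
move=> x_gt0; have /RleP := Rpower.exp_ineq1_le (- Rpower.ln x).
rewrite Rpower.exp_Ropp Rpower.exp_ln; last exact/RltP.
by rewrite RinvE lerBlDr addrC -lerBlDr.
Qed.

Section UniformSpace.
Variables (Omega A B : finType) (S : {pred Omega}) (X : Omega -> A) (Y : Omega -> B).
Hypothesis S_neq0 : (0 < #|[pred w | S w]|)%N.

Local Notation pX a := (uprob S (fun w => X w == a)).
Local Notation pY b := (uprob S (fun w => Y w == b)).
Local Notation pXY a b := (uprob S (fun w => (X w == a) && (Y w == b))).

(* [uprob] and [mutual_info] are elaborated with Stdlib's operations on [R];
   the next two lemmas restate them with those of MathComp. *)
Lemma uprobE E :
  uprob S E = #|[pred w | S w && E w]|%:R / #|[pred w | S w]|%:R.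
Proof. by rewrite /uprob RdivE. Qed.

Lemma mutual_infoE :
  mutual_info S X Y = \sum_a \sum_b
    if pXY a b == 0 then 0 else pXY a b * Rpower.ln (pXY a b / (pX a * pY b))%R.
Proof. by []. Qed.

Lemma uprob_ge0 E : 0 <= uprob S E.
Proof. by rewrite uprobE divr_ge0. Qed.

Lemma uprob_eq0 E : (uprob S E == 0) = [forall (w | S w), ~~ E w].
Proof.
rewrite uprobE mulf_eq0 invr_eq0 !pnatr_eq0 [X in _ || X]gtn_eqF // orbF.
apply/pred0P/forall_inP => [E0 w Sw|E0 w /=].
  by have := E0 w; rewrite /= Sw /= => ->.
by apply/negP=> /andP[/E0/negP].
Qed.

Lemma uprob_partition (T : finType) (Z : Omega -> T) E :
  uprob S E = \sum_c uprob S (fun w => E w && (Z w == c)).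
Proof.
rewrite uprobE; under eq_bigr do rewrite uprobE.
rewrite -mulr_suml -natr_sum; congr (_%:R / _).
rewrite -sum1_card (partition_big Z predT) //=; apply: eq_bigr => c _.
by rewrite -sum1_card; apply: eq_bigl => w; rewrite /= !inE andbA.
Qed.

Lemma uprobT : uprob S predT = 1.
Proof.
have S_T : [pred w | S w && predT w] =i [pred w | S w].
  by move=> w; rewrite !inE andbT.
by rewrite uprobE (eq_card S_T) divff // pnatr_eq0 -lt0n.
Qed.

Lemma sum_pX : \sum_a pX a = 1.
Proof. by rewrite -uprobT (uprob_partition X). Qed.

Lemma sum_pY : \sum_b pY b = 1.
Proof. by rewrite -uprobT (uprob_partition Y). Qed.

Lemma sum_pXY : \sum_a \sum_b pXY a b = 1.
Proof.
by rewrite -sum_pX; apply: eq_bigr => a _; rewrite (uprob_partition Y).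
Qed.

(** Joint counts that do not depend on a make X uniform and independent of Y. *)
Lemma mutual_info_eq0 (c : B -> nat) :
  (forall a b, #|[pred w | S w && ((X w == a) && (Y w == b))]| = c b) ->
  mutual_info S X Y = 0.
Proof.
move=> cE; set s : R := #|[pred w | S w]|%:R.
have s_neq0 : s != 0 by rewrite pnatr_eq0 -lt0n.
have pXYE a b : pXY a b = (c b)%:R / s by rewrite uprobE cE.
have pYE b : pY b = #|A|%:R * (c b)%:R / s.
  rewrite (uprob_partition X) -mulrA -sumr_const mulr_suml.
  apply: eq_bigr => a _; rewrite mul1r -(pXYE a).
  by rewrite !uprobE; congr (_%:R / _); apply: eq_card => w; rewrite !inE [X in _ && X]andbC.
have pXE a : pX a = (\sum_b (c b)%:R) / s.
  by rewrite (uprob_partition Y) mulr_suml; apply: eq_bigr => b _.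
have sE : s = #|A|%:R * \sum_b (c b)%:R.
  have := sum_pX; under eq_bigr do rewrite pXE.
  rewrite sumr_const -[_ *+ _ in LHS]mulr_natl mulrA => /(congr1 ( *%R^~ s)).
  by rewrite mul1r divfK.
rewrite mutual_infoE big1 // => a _; rewrite big1 // => b _ /=.
case: ifPn => // p_neq0.
have -> : pX a * pY b = pXY a b.
  rewrite pXYE pXE pYE -(mulrA #|A|%:R) [LHS]mulrA.
  by rewrite [X in X * _ = _]mulrAC (mulrC _ #|A|%:R) -sE divff // mul1r.
by rewrite divff // Rpower.ln_1 mulr0.
Qed.

(* Gibbs' inequality, keeping the mass of the product law off the support of
   the joint law. *)
Lemma mutual_info_ge :
  \sum_a \sum_(b | pXY a b == 0) pX a * pY b <= mutual_info S X Y.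
Proof.
pose N a b : R := if pXY a b == 0 then pX a * pY b else 0.
rewrite (eq_bigr (fun a => \sum_b N a b)); last by move=> a _; rewrite big_mkcond.
(* The bound holds term by term: off the support both sides are 0, and on it [N] vanishes and the
   logarithm bound applies. *)
have: \sum_a \sum_b (pXY a b - pX a * pY b + N a b) <= mutual_info S X Y.
  rewrite mutual_infoE; apply: ler_sum => a _; apply: ler_sum => b _ /=; rewrite /N.
  have [->|p_neq0] := eqVneq (pXY a b) 0; first by rewrite sub0r addNr.
  have p_gt0 : 0 < pXY a b by rewrite lt_neqAle eq_sym p_neq0 uprob_ge0.
  have pXY0 E : (forall w, S w -> ~~ E w -> (X w == a) && (Y w == b) = false) ->
      uprob S E != 0.
    move=> sub; apply: contraNneq p_neq0 => /eqP; rewrite !uprob_eq0.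
    by move=> /forall_inP E0; apply/forall_inP=> w Sw; rewrite (sub w Sw (E0 w Sw)).
  have pa_gt0 : 0 < pX a.
    by rewrite lt_neqAle eq_sym uprob_ge0 andbT pXY0 // => w _ /negPf->.
  have pb_gt0 : 0 < pY b.
    by rewrite lt_neqAle eq_sym uprob_ge0 andbT pXY0 // => w _ /negPf->; rewrite andbF.
  set p := pXY a b in p_gt0 *; set pq := pX a * pY b.
  have pq_gt0 : 0 < pq by rewrite mulr_gt0.
  have: p * (1 - (p / pq)^-1) <= p * Rpower.ln (p / pq).
    by rewrite ler_pM2l // ln_ge_subVr // divr_gt0.
  by rewrite addr0 invf_div mulrBr mulr1 [p * (pq / p)]mulrC divfK ?gt_eqF.
(* The joint and product laws both have total mass 1, so only the sum of [N] is left. *)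
apply: le_trans; rewrite le_eqVlt; apply/orP; left; apply/eqP.
under [RHS]eq_bigr do rewrite big_split sumrB /=.
rewrite big_split sumrB /= sum_pXY.
under [X in 1 - X]eq_bigr do rewrite -mulr_sumr sum_pY mulr1.
by rewrite sum_pX subrr add0r.
Qed.

(** The values [X w1] and [Y w2] each have positive probability but never occur together, so the
    product law has mass off the support. *)
Lemma mutual_info_gt0 w1 w2 :
  S w1 -> S w2 -> (forall w, S w -> X w = X w1 -> Y w <> Y w2) ->
  0 < mutual_info S X Y.
Proof.
move=> S1 S2 noXY; apply: lt_le_trans mutual_info_ge.
have pos a b : 0 <= pX a * pY b by rewrite mulr_ge0 ?uprob_ge0.
have pos1 : 0 < pX (X w1).
  rewrite lt_neqAle eq_sym uprob_ge0 uprob_eq0 andbT.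
  by apply/forall_inPn; exists w1; rewrite ?eqxx.
have pos2 : 0 < pY (Y w2).
  rewrite lt_neqAle eq_sym uprob_ge0 uprob_eq0 andbT.
  by apply/forall_inPn; exists w2; rewrite ?eqxx.
rewrite (bigD1 (X w1)) //= (bigD1 (Y w2)) /=; last first.
  rewrite uprob_eq0; apply/forall_inP=> w Sw; apply/negP=> /andP[/eqP e1 /eqP].
  exact: noXY.
apply: ltr_pwDl; last by apply: sumr_ge0 => a _; apply: sumr_ge0.
by apply: ltr_pwDl; [apply: mulr_gt0 | apply: sumr_ge0].
Qed.

End UniformSpace.

(** * Security parameter *)

Section Security.
Variables (F : finFieldType) (m n : nat) (C : {vspace 'M[F]_(m, n)}).
Variable psi : 'Hom('rV[F]_(info_param C), 'M[F]_(m, n)).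

(** Translation by some D0 in C with [D0 *m B^T = psi a *m B^T] matches the D that yield b under
    message a with those that yield b under message 0, so the count does not depend on a. *)
Lemma secure_for_onto (mu : nat) :
  (forall (B : 'M[F]_(mu, n)) D, exists2 D', D' \in C & D' *m B^T = D *m B^T) ->
  secure_for psi mu.
Proof.
move=> onto B.
apply: (@mutual_info_eq0 _ _ _ _ _ _ _ (fun b => #|[pred D | (D \in C) && (D *m B^T == b)]|)).
  by apply/card_gt0P; exists (0, 0); rewrite !inE mem0v.
move=> a b; have [D0 D0C D0B] := onto B (psi a).
have inj : injective (fun D : 'M[F]_(m, n) => (a, D - D0)) by move=> D1 D2 [/addIr].
rewrite -(card_image inj); apply: eq_card => -[x D]; rewrite !inE /=.
apply/idP/imageP => [/and3P[DC /eqP-> /eqP Db]|[D1 /andP[DC1 /eqP Db] [-> ->]]].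
  exists (D + D0); last by rewrite addrK.
  by rewrite inE memvD // mulmxDl D0B addrC -mulmxDl Db eqxx.
by rewrite memvB // eqxx mulmxDl mulmxBl D0B addrC subrK Db eqxx.
Qed.

(** The component of D in C is harmless, so D may be taken as [psi x]. If C missed [psi x *m B^T],
    message 0 could never produce this observation, which message x can, and information would
    leak. *)
Lemma secure_for_mulmx (mu : nat) (B : 'M[F]_(mu, n)) (D : 'M[F]_(m, n)) :
  (C + limg psi == fullv)%VS -> secure_for psi mu ->
  exists2 D', D' \in C & D' *m B^T = D *m B^T.
Proof.
move=> /eqP fullE /(_ B) sec0.
have: D \in (C + limg psi)%VS by rewrite fullE memvf.
case/memv_addP=> D1 D1C [_ /memv_imgP[x _ ->] ->].
suff [D2 D2C D2B] : exists2 D2, D2 \in C & D2 *m B^T = psi x *m B^T.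
  by exists (D1 + D2); rewrite ?memvD // !mulmxDl D2B.
have [/exists_inP[D2 D2C /eqP D2B]|noD2] :=
  boolP [exists (D2 | D2 \in C), D2 *m B^T == psi x *m B^T]; first by exists D2.
suff /gt_eqF/eqP[] : 0 < mutual_info (fun w : 'rV[F]_(info_param C) * 'M[F]_(m, n) => w.2 \in C)
      (fun w => w.1) (fun w => (psi w.1 + w.2) *m B^T) by [].
apply: (@mutual_info_gt0 _ _ _ _ _ _ _ (0, 0) (x, 0)); rewrite /= ?mem0v //.
  by apply/card_gt0P; exists (0, 0); rewrite !inE mem0v.
move=> [y D2] /= D2C ->; rewrite linear0 add0r addr0 => /eqP D2B.
by case/exists_inP: noD2; exists D2.
Qed.

End Security.

(** The dual of the image of [f] has codimension l. Any mu > t is excluded by the codeword of rank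
    at most t + 1. *)
Lemma dual_code_security (F : finFieldType) (m n l t : nat)
    (f : {linear 'rV[F]_l -> 'M[F]_(m, n)}) :
  (0 < l)%N -> (forall u, u != 0 -> (t < \rank (f u))%N) ->
  (exists2 u, u != 0 & (\rank (f u) <= t.+1)%N) ->
  exists C : {vspace 'M[F]_(m, n)},
    [/\ C != fullv%VS, info_param C = l & has_security_param C t].
Proof.
move=> l_gt0 rk_f [u u_neq0 rk_u]; exists (dual_code f).
have dimC := dim_dual_code rk_f.
have infoC : info_param (dual_code f) = l by rewrite /info_param -dimC addKn.
split=> //.
  apply: contraTneq l_gt0 => fullC.
  by move: dimC; rewrite fullC dimvf /dim /= -lt0n; lia.
move=> psi [_ [_ fullE]]; split.
  by apply: secure_for_onto => B D; apply: dual_code_mulmx.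
move=> mu sec; rewrite leqNgt; apply/negP=> t_lt.
have fu_neq0 : f u != 0.
  by rewrite -mxrank_eq0 -lt0n (leq_ltn_trans _ (rk_f _ u_neq0)).
have [B [D]] := dual_code_not_mulmx fu_neq0 (leq_trans rk_u t_lt).
by have [D' D'C D'B] := secure_for_mulmx B D fullE sec => /(_ _ D'C).
Qed.

(** * Codes attaining the Singleton bound, and the two existence statements *)

(** With k the ceiling of l / N, the bound l <= k N leaves room for an l-dimensional subcode of the
    Gabidulin code, and (k - 1) N < l makes the Singleton bound tight. *)
Lemma MRD_subcode (F : finFieldType) (M N l : nat)
    (k := ceil_div l N) (t := (M - k)%N) :
  (0 < M)%N -> (M <= N)%N -> (0 < l)%N -> (l <= M * N)%N ->
  exists f : {linear 'rV[F]_l -> 'M[F]_(M, N)},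
    (forall u, u != 0 -> (t < \rank (f u))%N) /\
    (exists2 u, u != 0 & (\rank (f u) <= t.+1)%N).
Proof.
move=> M_gt0 MN l_gt0 l_le; have N_gt0 := leq_trans M_gt0 MN.
have k_gt0 : (0 < k)%N by rewrite /k /ceil_div divn_gt0 //; lia.
have k_ub : (l <= k * N)%N.
  have := ltn_ceil (l + N.-1) N_gt0; rewrite -/(ceil_div l N) -/k; lia.
have k_lb : (k.-1 * N < l)%N.
  have := leq_trunc_div (l + N.-1) N; rewrite -/(ceil_div l N) -/k.
  case: k k_gt0 {k_ub t} => // k' _; rewrite mulSn /=; lia.
have kM : (k <= M)%N.
  have : (k.-1 * N < M * N)%N by apply: leq_trans k_lb l_le.
  by rewrite ltn_mul2r N_gt0 /=; lia.
clearbody k.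
have [L dimL] := ext_field_exists F N_gt0; subst N.
(* [pid_mx l] pads the l message coordinates with zeros. *)
exists (gabidulin (k := k) M \o mulmxr (pid_mx l)); split=> [u u_neq0|].
  apply: gabidulin_rank => //; apply: contra_neq u_neq0 => /= u0.
  have fl : row_free (pid_mx l : 'M[F]_(l, k * dim L)).
    by rewrite /row_free rank_pid_mx.
  by apply: (row_free_inj fl); rewrite u0 mul0mx.
(* Killing k - 1 rows leaves rank at most M - (k - 1), which is [t.+1] since 1 <= k <= M. *)
have [|u u_neq0 rk_u] := small_rank_codeword (s := k.-1)
  (gabidulin (L := L) (k := k) M \o mulmxr (pid_mx l)) _ k_lb; first lia.
by exists u => //; apply: leq_trans rk_u _; rewrite /t; lia.
Qed.

Theorem theorem2 (F : finFieldType) (m n : nat) :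
  leq 1 m -> leq 1 n ->
  (forall l : nat, leq 1 l -> leq l (muln m n) ->
     exists C : {vspace 'M[F]_(m, n)},
       C != fullv%VS /\ info_param C = l /\
       has_security_param C (subn (minn m n) (ceil_div l (maxn m n)))) /\
  (forall t : nat, leq 1 t -> leq t (subn (minn m n) 1) ->
     exists C : {vspace 'M[F]_(m, n)},
       C != fullv%VS /\ has_security_param C t /\
       info_param C = muln (maxn m n) (subn (minn m n) t)).
Proof.
move=> m_gt0 n_gt0.
have part1 l : leq 1 l -> leq l (muln m n) ->
     exists C : {vspace 'M[F]_(m, n)},
       C != fullv%VS /\ info_param C = l /\
       has_security_param C (subn (minn m n) (ceil_div l (maxn m n))).
  move=> l_gt0 l_le.
  suff [f [rk_gt rk_le]] : exists f : {linear 'rV[F]_l -> 'M[F]_(m, n)},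
      (forall u, u != 0 -> (minn m n - ceil_div l (maxn m n) < \rank (f u))%N) /\
      (exists2 u, u != 0 & (\rank (f u) <= (minn m n - ceil_div l (maxn m n)).+1)%N).
    by have [C [? ? ?]] := dual_code_security l_gt0 rk_gt rk_le; exists C.
  have [mn|nm] := leqP m n; first exact: MRD_subcode.
  (* For n < m, the transposed code is used: transposition preserves rank. *)
  rewrite mulnC in l_le.
  have [f [rk_gt [u u0 rk_le]]] := MRD_subcode F n_gt0 (ltnW nm) l_gt0 l_le.
  exists (trmx \o f); split=> [v /rk_gt|]; first by rewrite /= mxrank_tr.
  by exists u; rewrite //= mxrank_tr.
split=> // t t_gt0 t_le.
have N_gt0 : (0 < maxn m n)%N by rewrite leq_max m_gt0.
have [||C [? [infoC secC]]] := part1 (maxn m n * (minn m n - t))%N.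
- by rewrite muln_gt0 N_gt0; lia.
- have -> : (m * n = maxn m n * minn m n)%N by case: leqP => _ //; rewrite mulnC.
  by rewrite leq_mul2l leq_subr orbT.
exists C; split=> //; split=> //; move: secC; rewrite /ceil_div.
(* Here l is a multiple of the divisor, so the rounding term adds nothing and the quotient is min(m,
   n) - t. *)
rewrite mulnC divnMDl // divn_small ?prednK // addn0 subKn //; lia.
Qed.
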